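(* Let $f$ be a regular octonionic polynomial of degree $n>0$ and let $\alpha_1\in V(f)$. Then there exist $\alpha_2,\ldots,\alpha_n,c\in\mathbb{O}$ with $c\ne0$ and regular octonionic polynomials $f_0,f_1,\ldots,f_{n-1}$ with $f_0=f$ such that $$f_k(w)=(w-\alpha_{k+1})\ast f_{k+1}(w)\quad\text{for } k=0,1,\ldots,n-2,\qquad f_{n-1}(w)=(w-\alpha_n)\ast c.$$ Moreover, for every $k=1,\ldots,n-1$, $\alpha_{k+1}$ is a zero of $f_k$ and it is conjugate to a zero $\alpha'_{k+1}$ of $f$.
   Context: $\mathbb{O}$ is the real alternative division algebra of octonions. A regular octonionic polynomial of degree $n$ is a function $f:\mathbb{O}\to\mathbb{O}$, $f(w)=\sum_{i=0}^n w^i a_i$ with $a_i\in\mathbb{O}$, $a_n\ne0$. For $f=\sum_i w^ia_i$ and $g=\sum_j w^jb_j$, the product is $(f\ast g)(w)=\sum_k w^k\big(\sum_{i+j=k}a_ib_j\big)$. $V(f)$ is the zero set of $f$ in $\mathbb{O}$. Octonions $\alpha,\beta$ are conjugate iff $\beta\in\mathbb{S}_\alpha=\{\mathrm{Re}(\alpha)+|\mathrm{Im}(\alpha)|\,I : I\in\mathbb{O},\ I^2=-1\}$, equivalently iff they have the same trace $\alpha+\overline\alpha$ and the same norm. *)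

(* Defs.v *)
From HB Require Import structures.
From mathcomp Require Import all_boot all_order all_algebra.
From mathcomp Require Import ring lra.
From mathcomp Require Import classical_sets reals.

Set Implicit Arguments.
Unset Strict Implicit.
Unset Printing Implicit Defensive.

Import Order.TTheory GRing.Theory Num.Theory.

Local Open Scope classical_set_scope.
Local Open Scope ring_scope.

(* Cayley-Dickson doubling of an algebra with product [mul] and conjugation
   [conj]; there are several sign and side conventions, all of which give
   isomorphic octonions. *)
Definition cd_mul (V : zmodType) (mul : V -> V -> V) (conj : V -> V)
    (x y : V * V) : V * V :=
  (mul x.1 y.1 - mul (conj y.2) x.2, mul y.2 x.1 + mul x.2 (conj y.1)).

Definition cd_conj (V : zmodType) (conj : V -> V) (x : V * V) : V * V :=
  (conj x.1, - x.2).

Section Octonions.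
Variable R : realType.

(* A record, so that [octonion] does not inherit the componentwise ring
   structure of pairs; [R^o] makes the carrier a real vector space. *)
Record octonion := Oct {
  oval : ((R^o * R^o) * (R^o * R^o)) * ((R^o * R^o) * (R^o * R^o))
}.

Lemma ovalK : cancel oval Oct. Proof. by case. Qed.
HB.instance Definition _ := Choice.copy octonion (can_type ovalK).

Definition oadd (x y : octonion) : octonion := Oct (oval x + oval y).
Definition oopp (x : octonion) : octonion := Oct (- oval x).
Definition oscale (r : R) (x : octonion) : octonion := Oct (r *: oval x).

Fact oaddA : associative oadd.
Proof. by move=> x y z; rewrite /oadd addrA. Qed.
Fact oaddC : commutative oadd.
Proof. by move=> x y; rewrite /oadd addrC. Qed.
Fact oadd0 : left_id (Oct 0) oadd.
Proof. by case=> x; rewrite /oadd add0r. Qed.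
Fact oaddN : left_inverse (Oct 0) oopp oadd.
Proof. by case=> x; rewrite /oadd addNr. Qed.
HB.instance Definition _ :=
  GRing.isZmodule.Build octonion oaddA oaddC oadd0 oaddN.

Fact oscaleA a b x : oscale a (oscale b x) = oscale (a * b) x.
Proof. by rewrite /oscale scalerA. Qed.
Fact oscale1 : left_id 1 oscale.
Proof. by case=> x; rewrite /oscale scale1r. Qed.
Fact oscaleDr : right_distributive oscale +%R.
Proof. by move=> a x y; congr Oct; rewrite scalerDr. Qed.
Fact oscaleDl x : {morph oscale^~ x : a b / a + b}.
Proof. by move=> a b; congr Oct; rewrite scalerDl. Qed.
HB.instance Definition _ :=
  GRing.Zmodule_isLmodule.Build R octonion oscaleA oscale1 oscaleDr oscaleDl.

Fact oval_is_linear : linear oval. Proof. by []. Qed.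
HB.instance Definition _ :=
  GRing.isLinear.Build R octonion _ _ oval oval_is_linear.

Definition omul (x y : octonion) : octonion :=
  Oct (cd_mul (cd_mul (cd_mul *%R id) (cd_conj id)) (cd_conj (cd_conj id))
         (oval x) (oval y)).

Definition oconj (x : octonion) : octonion :=
  Oct (cd_conj (cd_conj (cd_conj id)) (oval x)).

Definition oreal (r : R) : octonion := Oct (((r, 0), (0, 0)), ((0, 0), (0, 0))).

Definition oone : octonion := oreal 1.

Definition oRe (x : octonion) : R := (oval x).1.1.1.

Definition oIm (x : octonion) : octonion := x - oreal (oRe x).

(* [omul x (oconj x)] is real, see [omul_conj]. *)
Definition onorm (x : octonion) : R := Num.sqrt (oRe (omul x (oconj x))).

Definition opow (x : octonion) (i : nat) : octonion := iter i (omul x) oone.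

Definition osphere (x : octonion) : set octonion :=
  [set y | exists2 I, omul I I = - oone
                    & y = oreal (oRe x) + onorm (oIm x) *: I].

Definition oconjugate (x y : octonion) : Prop := osphere x y.

(* Polynomials [\sum_i w ^ i a_i] are represented by their coefficients, as in
   [{poly _}] (whose coefficients must form an associative ring); by
   [oeval_inj] a regular polynomial is determined by the function it defines.
   Since [last 0 [::] = 0], the zero polynomial is not in [regpoly]. *)
Record regpoly := RegPoly {
  ocoefs :> seq octonion;
  _ : last 0 ocoefs != 0
}.

Definition odegree (f : regpoly) : nat := (size f).-1.

Definition oeval (a : seq octonion) (w : octonion) : octonion :=
  \sum_(i < size a) omul (opow w i) a`_i.

Definition ozeros (f : regpoly) : set octonion := [set w | oeval f w = 0].

Definition ostar (a b : seq octonion) : seq octonion :=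
  mkseq (fun k => \sum_(i < k.+1) omul a`_i b`_(k - i)) (size a + size b).-1.

(* the coefficients of [w - x] and of the constant [x] *)
Definition oXsub (x : octonion) : seq octonion := [:: - x; oone].
Definition oconst (x : octonion) : seq octonion := [:: x].

Lemma octP (P : octonion -> Prop) :
  (forall a b c d e f g h : R, P (Oct (((a, b), (c, d)), ((e, f), (g, h))))) ->
  forall x, P x.
Proof. by move=> PT [[[[? ?] [? ?]] [[? ?] [? ?]]]]; exact: PT. Qed.

Let pairD (U V : zmodType) (a c : U) (b d : V) :
  (a, b) + (c, d) = (a + c, b + d).
Proof. by []. Qed.

Let pairN (U V : zmodType) (a : U) (b : V) : - (a, b) = (- a, - b).
Proof. by []. Qed.

Local Ltac octring := congr (Oct (((_, _), (_, _)), ((_, _), (_, _)))); ring.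

Lemma omulE (x0 x1 x2 x3 x4 x5 x6 x7 y0 y1 y2 y3 y4 y5 y6 y7 : R) :
  omul (Oct (((x0, x1), (x2, x3)), ((x4, x5), (x6, x7))))
       (Oct (((y0, y1), (y2, y3)), ((y4, y5), (y6, y7)))) =
  Oct (((x0 * y0 - x1 * y1 - x2 * y2 - x3 * y3 - x4 * y4 - x5 * y5 - x6 * y6 - x7 * y7,
     x0 * y1 + x1 * y0 + x2 * y3 + x4 * y5 + x7 * y6 - x3 * y2 - x5 * y4 - x6 * y7),
    (x0 * y2 + x2 * y0 + x3 * y1 + x4 * y6 + x5 * y7 - x1 * y3 - x6 * y4 - x7 * y5,
     x1 * y2 + x0 * y3 + x3 * y0 + x6 * y5 + x4 * y7 - x2 * y1 - x7 * y4 - x5 * y6)),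
   ((x0 * y4 + x4 * y0 + x5 * y1 + x6 * y2 + x7 * y3 - x1 * y5 - x2 * y6 - x3 * y7,
     x1 * y4 + x0 * y5 + x3 * y6 + x5 * y0 + x7 * y2 - x2 * y7 - x4 * y1 - x6 * y3),
    (x2 * y4 + x0 * y6 + x1 * y7 + x5 * y3 + x6 * y0 - x3 * y5 - x4 * y2 - x7 * y1,
     x2 * y5 + x3 * y4 + x0 * y7 + x6 * y1 + x7 * y0 - x1 * y6 - x5 * y2 - x4 * y3))).
Proof.
rewrite /omul /cd_mul /cd_conj; cbn [oval fst snd].
do 3 (rewrite ?(pairD, pairN); cbn [oval fst snd]).
by octring.
Qed.

Lemma oconjE (a b c d e f g h : R) :
  oconj (Oct (((a, b), (c, d)), ((e, f), (g, h)))) =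
  Oct (((a, - b), (- c, - d)), ((- e, - f), (- g, - h))).
Proof. by []. Qed.

Lemma oRe_omul_conj (a b c d e f g h : R) (x : octonion) :
  x = Oct (((a, b), (c, d)), ((e, f), (g, h))) ->
  oRe (omul x (oconj x)) =
  a ^+ 2 + b ^+ 2 + c ^+ 2 + d ^+ 2 + e ^+ 2 + f ^+ 2 + g ^+ 2 + h ^+ 2.
Proof. by move=> ->; rewrite oconjE omulE /oRe; cbn [oval fst snd]; ring. Qed.

Lemma omul_conj x : omul x (oconj x) = oreal (oRe (omul x (oconj x))).
Proof.
elim/octP: x => a b c d e f g h; rewrite oconjE omulE /oRe /oreal.
by cbn [oval fst snd]; octring.
Qed.

Lemma omul1l x : omul oone x = x.
Proof.
by elim/octP: x => a b c d e f g h; rewrite /oone /oreal omulE; octring.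
Qed.

Lemma omul1r x : omul x oone = x.
Proof.
by elim/octP: x => a b c d e f g h; rewrite /oone /oreal omulE; octring.
Qed.

Lemma omul_altl x y : omul x (omul x y) = omul (omul x x) y.
Proof.
elim/octP: x => x0 x1 x2 x3 x4 x5 x6 x7.
elim/octP: y => y0 y1 y2 y3 y4 y5 y6 y7.
by rewrite !omulE; octring.
Qed.

Lemma omul_altr x y : omul (omul x y) y = omul x (omul y y).
Proof.
elim/octP: x => x0 x1 x2 x3 x4 x5 x6 x7.
elim/octP: y => y0 y1 y2 y3 y4 y5 y6 y7.
by rewrite !omulE; octring.
Qed.

Lemma onormM x y : onorm (omul x y) = onorm x * onorm y.
Proof.
elim/octP: x => x0 x1 x2 x3 x4 x5 x6 x7.
elim/octP: y => y0 y1 y2 y3 y4 y5 y6 y7.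
rewrite /onorm -sqrtrM; last first.
  by rewrite (oRe_omul_conj erefl) !addr_ge0 ?sqr_ge0.
congr Num.sqrt; rewrite omulE !(oRe_omul_conj erefl).
by ring.
Qed.

Lemma onorm_eq0 x : onorm x = 0 -> x = 0.
Proof.
elim/octP: x => a b c d e f g h; rewrite /onorm (oRe_omul_conj erefl).
move/eqP; rewrite sqrtr_eq0 => s0.
have z (t : R) : t ^+ 2 <= 0 -> t = 0.
  by move=> t0; apply/eqP; rewrite -sqrf_eq0 eq_le t0 sqr_ge0.
have := sqr_ge0 h; have := sqr_ge0 g; have := sqr_ge0 f; have := sqr_ge0 e.
have := sqr_ge0 d; have := sqr_ge0 c; have := sqr_ge0 b; have := sqr_ge0 a.
move=> *.
have [-> -> -> ->] : [/\ a = 0, b = 0, c = 0 & d = 0].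
  by split; apply: z; lra.
have [-> -> -> ->] : [/\ e = 0, f = 0, g = 0 & h = 0].
  by split; apply: z; lra.
by [].
Qed.

Lemma oscaleE (t a b c d e f g h : R) :
  t *: Oct (((a, b), (c, d)), ((e, f), (g, h))) =
  Oct (((t * a, t * b), (t * c, t * d)), ((t * e, t * f), (t * g, t * h))).
Proof. by []. Qed.

Lemma omul_oreal t x : omul (oreal t) x = t *: x.
Proof.
elim/octP: x => a b c d e f g h; rewrite /oreal omulE oscaleE.
by octring.
Qed.

Lemma opow_oreal t i : opow (oreal t) i = oreal (t ^+ i).
Proof.
elim: i => [//|i IH]; rewrite /opow iterS -/(opow _ _) IH exprS /oreal omulE.
by octring.
Qed.

Lemma oeval_oreal a t : oeval a (oreal t) = \sum_(i < size a) t ^+ i *: a`_i.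
Proof. by apply: eq_bigr => i _; rewrite opow_oreal omul_oreal. Qed.

Lemma coef_inj_lin (V : lmodType R) (c0 : V -> R) (a b : seq V) i :
  linear (c0 : V -> R^o) ->
  (forall t : R, \sum_(i < size a) t ^+ i *: a`_i =
                 \sum_(i < size b) t ^+ i *: b`_i) ->
  c0 a`_i = c0 b`_i.
Proof.
move=> c0L.
pose c : {linear V -> R^o} :=
  HB.pack (c0 : V -> R^o) (GRing.isLinear.Build R V R^o _ c0 c0L).
rewrite -[c0]/(c : V -> R).
pose p (s : seq V) : {poly R} := \poly_(i < size s) (c s`_i : R).
have pE s j : (p s)`_j = c s`_j.
  by rewrite coef_poly; case: ltnP => // h; rewrite nth_default // linear0.
have pv s t : (p s).[t] = c (\sum_(i < size s) t ^+ i *: s`_i).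
  rewrite horner_poly linear_sum; apply: eq_bigr => j _.
  by rewrite linearZ mulrC.
move=> ab; rewrite -!pE; suff -> : p a = p b by [].
have r0 t : (p a - p b).[t] = 0 by rewrite hornerD hornerN !pv ab subrr.
apply/eqP; rewrite -subr_eq0; apply: contraT => nz.
pose rs := [seq k%:R : R | k <- iota 0 (size (p a - p b))].
have := max_poly_roots nz (_ : all (root _) rs) (_ : uniq rs).
rewrite size_map size_iota ltnn; apply.
  by apply/allP => t _; rewrite /root r0.
rewrite map_inj_uniq ?iota_uniq // => k l /eqP; rewrite eqr_nat => /eqP //.
Qed.

Lemma oeval_inj (f g : regpoly) :
  (forall w, oeval f w = oeval g w) -> ocoefs f = ocoefs g.
Proof.
move=> fg.
have fgt t : \sum_(i < size f) t ^+ i *: f`_i = \sum_(i < size g) t ^+ i *: g`_i.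
  by rewrite -!oeval_oreal fg.
have E i : f`_i = g`_i.
  have L (c : octonion -> R) : linear (c : octonion -> R^o) -> c f`_i = c g`_i.
    by move=> cL; exact: coef_inj_lin cL fgt.
  have := L (fun x => (oval x).2.2.2) (fun _ _ _ => erefl).
  have := L (fun x => (oval x).2.2.1) (fun _ _ _ => erefl).
  have := L (fun x => (oval x).2.1.2) (fun _ _ _ => erefl).
  have := L (fun x => (oval x).2.1.1) (fun _ _ _ => erefl).
  have := L (fun x => (oval x).1.2.2) (fun _ _ _ => erefl).
  have := L (fun x => (oval x).1.2.1) (fun _ _ _ => erefl).
  have := L (fun x => (oval x).1.1.2) (fun _ _ _ => erefl).
  have := L (fun x => (oval x).1.1.1) (fun _ _ _ => erefl).
  case: f`_i => [[[[? ?] [? ?]] [[? ?] [? ?]]]].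
  case: g`_i => [[[[? ?] [? ?]] [[? ?] [? ?]]]].
  by cbn [oval fst snd] => -> -> -> -> -> -> -> ->.
have le (p q : regpoly) : (forall i, p`_i = q`_i) -> (size p <= size q)%N.
  case: p => [s s0] /= pq; rewrite leqNgt; apply: contra s0 => h.
  by rewrite -nth_last pq nth_default // -ltnS (ltn_predK h).
apply: (@eq_from_nth _ 0) => [|i _]; last exact: E.
by apply/eqP; rewrite eqn_leq !le.
Qed.

End Octonions.

(* Main.v *)
(* Embed the octonions in their complexification, with the complex-bilinear
   norm form N.  Write an octonion as w = x + y I with I an imaginary unit and
   put z = x + i y.  If f(z) = U + i V in the complexified octonions, then
   f(w) = U + I V.  Hence f vanishes somewhere on the sphere x + y S iff U = - I V
   for some imaginary unit I, that is iff |U| = |V| and <U, V> = 0, that is iff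
   N(f(z)) = 0.  As N(f(z)) is a polynomial in z of degree 2 deg f, it has a
   complex root, so f has a zero; as N is multiplicative, the spheres carrying
   zeros of g also carry zeros of (w - al) * g.  Dividing out zeros one at a time
   by Horner's scheme gives the factorization. *)

Require Import Defs.
From HB Require Import structures.
From mathcomp Require Import all_boot all_order all_algebra.
From mathcomp Require Import ring complex.
From mathcomp Require Import classical_sets reals.

Set Implicit Arguments.
Unset Strict Implicit.
Unset Printing Implicit Defensive.

Import Order.TTheory GRing.Theory Num.Theory.

Local Open Scope classical_set_scope.
Local Open Scope ring_scope.

(** * Inner product, quadratic equation and imaginary units of the octonions *)

Section OctonionAlgebra.
Variable R : realType.
Implicit Types (x y z w u v I : octonion R) (r s t : R).

Definition oinner x y : R := oRe (omul x (oconj y)).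

Lemma oaddE (a b c d e f g h a' b' c' d' e' f' g' h' : R) :
  Oct (((a, b), (c, d)), ((e, f), (g, h))) +
    Oct (((a', b'), (c', d')), ((e', f'), (g', h'))) =
  Oct (((a + a', b + b'), (c + c', d + d')),
       ((e + e', f + f'), (g + g', h + h'))).
Proof. by []. Qed.

Lemma oinnerE (a b c d e f g h a' b' c' d' e' f' g' h' : R) :
  oinner (Oct (((a, b), (c, d)), ((e, f), (g, h))))
    (Oct (((a', b'), (c', d')), ((e', f'), (g', h')))) =
  a * a' + b * b' + c * c' + d * d' + e * e' + f * f' + g * g' + h * h'.
Proof.
by rewrite /oinner oconjE omulE /oRe; cbn [oval fst snd]; ring.
Qed.

Local Ltac octcases x := elim/octP: x => ? ? ? ? ? ? ? ?.
Local Ltac octring :=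
  rewrite /oone /oreal ?(oconjE, omulE, oscaleE, oaddE);
  congr (Oct (((_, _), (_, _)), ((_, _), (_, _)))); ring.

Lemma oinnerC x y : oinner x y = oinner y x.
Proof. by octcases x; octcases y; rewrite !oinnerE; ring. Qed.

Lemma oinnerDl x y z : oinner (x + y) z = oinner x z + oinner y z.
Proof. by octcases x; octcases y; octcases z; rewrite oaddE !oinnerE; ring. Qed.

Lemma oinnerZl t x y : oinner (t *: x) y = t * oinner x y.
Proof. by octcases x; octcases y; rewrite oscaleE !oinnerE; ring. Qed.

Lemma oinnerDr x y z : oinner x (y + z) = oinner x y + oinner x z.
Proof. by rewrite !(oinnerC x) oinnerDl. Qed.

Lemma oinnerZr t x y : oinner x (t *: y) = t * oinner x y.
Proof. by rewrite !(oinnerC x) oinnerZl. Qed.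

Lemma oinner0l x : oinner 0 x = 0.
Proof. by rewrite -(scale0r 0) oinnerZl mul0r. Qed.

Lemma oinner_suml m (F : 'I_m -> octonion R) y :
  oinner (\sum_i F i) y = \sum_i oinner (F i) y.
Proof.
elim/big_ind2: _ => // [|_ x1 _ x2 <- <-]; first exact: oinner0l.
exact: oinnerDl.
Qed.

Lemma oinner_sumr m (F : 'I_m -> octonion R) x :
  oinner x (\sum_i F i) = \sum_i oinner x (F i).
Proof.
by rewrite oinnerC oinner_suml; apply: eq_bigr => i _; rewrite oinnerC.
Qed.

Lemma onorm_inner x : onorm x ^+ 2 = oinner x x.
Proof.
octcases x; rewrite /onorm sqr_sqrtr // (oRe_omul_conj erefl).
by rewrite !addr_ge0 ?sqr_ge0.
Qed.

Lemma oinner_eq0 x : oinner x x = 0 -> x = 0.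
Proof. by move/eqP; rewrite -onorm_inner sqrf_eq0 => /eqP /onorm_eq0. Qed.

Lemma omulDr x y z : omul x (y + z) = omul x y + omul x z.
Proof. by octcases x; octcases y; octcases z; octring. Qed.

Lemma omulDl x y z : omul (x + y) z = omul x z + omul y z.
Proof. by octcases x; octcases y; octcases z; octring. Qed.

Lemma omulZl t x y : omul (t *: x) y = t *: omul x y.
Proof. by octcases x; octcases y; octring. Qed.

Lemma omulZr t x y : omul x (t *: y) = t *: omul x y.
Proof. by octcases x; octcases y; octring. Qed.

Lemma omulx0 x : omul x 0 = 0.
Proof. by rewrite -(scale0r 0) omulZr !scale0r. Qed.

Lemma omulNl x y : omul (- x) y = - omul x y.
Proof. by rewrite -!scaleN1r omulZl. Qed.

Lemma omul_sumr m (F : 'I_m -> octonion R) x :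
  omul x (\sum_i F i) = \sum_i omul x (F i).
Proof.
elim/big_ind2: _ => // [|_ x1 _ x2 <- <-]; first exact: omulx0.
exact: omulDr.
Qed.

Lemma omul_sqr x : omul x x = oRe x *+ 2 *: x - oinner x x *: oone R.
Proof.
octcases x; rewrite oinnerE -scaleNr /oRe; cbn [oval fst snd].
rewrite /oone /oreal !oscaleE.
by octring.
Qed.

Lemma oconj_sub x : oconj x = oRe x *+ 2 *: oone R - x.
Proof.
octcases x; rewrite -scaleN1r /oRe; cbn [oval fst snd].
rewrite /oone /oreal !oscaleE.
by octring.
Qed.

(** The conjugate of [y] lies in the span of 1 and [y], so alternativity replaces associativity.
    This solves [omul I V = - U] for [I] below. *)
Lemma omulVK x y : omul (omul x (oconj y)) y = oinner y y *: x.
Proof.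
rewrite oconj_sub omulDr omulDl omulZr omul1r omulZl -scaleN1r omulZr omulZl.
rewrite omul_altr omul_sqr omulDr -!scaleNr !omulZr omul1r scalerDr !scalerA.
by rewrite mulN1r scaleNr addrA subrr add0r mulN1r opprK.
Qed.

(** Polarized form of the multiplicativity of the norm. *)
Lemma oinner_mull u x y : oinner (omul u x) (omul u y) = oinner u u * oinner x y.
Proof.
by octcases u; octcases x; octcases y; rewrite !omulE !oinnerE; ring.
Qed.

(** Left multiplication by [u] has left multiplication by [oconj u] as adjoint, and [u + oconj u] is
    twice the real part. *)
Lemma oinner_adj u x y :
  oinner (omul u x) y + oinner x (omul u y) = oRe u *+ 2 * oinner x y.
Proof.
octcases u; octcases x; octcases y; rewrite !omulE !oinnerE /oRe.
by cbn [oval fst snd]; ring.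
Qed.

Lemma oinner_mull_self u x : oinner (omul u x) x = oRe u * oinner x x.
Proof.
octcases u; octcases x; rewrite !omulE !oinnerE /oRe.
by cbn [oval fst snd]; ring.
Qed.

Lemma oreal_scale t : oreal t = t *: oone R.
Proof. by rewrite /oone; octring. Qed.

Lemma oReD x y : oRe (x + y) = oRe x + oRe y.
Proof. by []. Qed.

Lemma oReZ t x : oRe (t *: x) = t * oRe x.
Proof. by []. Qed.

Lemma oReN x : oRe (- x) = - oRe x.
Proof. by []. Qed.

Lemma opow_linear w i : exists r s, opow w i = r *: oone R + s *: w.
Proof.
elim: i => [|i [r [s IH]]]; first by exists 1, 0; rewrite scale1r scale0r addr0.
exists (- (s * oinner w w)), (r + s * (oRe w *+ 2)).
rewrite /opow iterS -/(opow w i) IH omulDr !omulZr omul1r omul_sqr.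
rewrite scalerBr !scalerA addrCA scalerDl scaleNr.
rewrite [in RHS]addrCA [in RHS]addrC addrA [LHS]addrC -!addrA.
by do !congr (_ + _); rewrite addrC.
Qed.

(** Powers of [w] lie in the span of 1 and [w], so the left alternative law suffices. *)
Lemma omul_powS w i x : omul (opow w i.+1) x = omul w (omul (opow w i) x).
Proof.
rewrite {1}/opow iterS -/(opow w i); have [r [s ->]] := opow_linear w i.
by rewrite omulDr !omulDl !omulZr !omulZl omulDr !omulZr omul_altl omul1l omul1r.
Qed.

Definition imag_unit I : Prop := oRe I = 0 /\ oinner I I = 1.

Lemma imag_unit_sqr I : imag_unit I -> omul I I = - oone R.
Proof.
by case=> re0 n1; rewrite omul_sqr re0 n1 mul0rn scale0r scale1r sub0r.
Qed.

Lemma imag_unit_exists : exists I, imag_unit I.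
Proof.
exists (Oct (((0, 1), (0, 0)), ((0, 0), (0, 0)))).
by split=> //; rewrite oinnerE; ring.
Qed.

Lemma oct_polar x :
  exists2 I, imag_unit I & x = oreal (oRe x) + onorm (oIm x) *: I.
Proof.
have imE : x = oreal (oRe x) + oIm x by rewrite /oIm addrC subrK.
have [n0|n0] := eqVneq (onorm (oIm x)) 0.
  have [I uI] := imag_unit_exists; exists I => //.
  by rewrite n0 scale0r addr0 {1}imE (onorm_eq0 n0) addr0.
exists ((onorm (oIm x))^-1 *: oIm x); last by rewrite scalerA divff ?scale1r.
split; last first.
  rewrite oinnerZl oinnerZr -onorm_inner; field; exact: n0.
by rewrite oReZ /oIm oReD oReN subrr mulr0.
Qed.

End OctonionAlgebra.

(** * Values on a sphere and the isotropy condition for a zero *)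

Section OctonionPolynomials.
Variable R : realType.
Implicit Types (x y w al : octonion R) (a b : seq (octonion R)).
Implicit Types (z : R[i]) (phi psi : nat -> R) (f g : regpoly R).

Definition osum phi a : octonion R := \sum_(i < size a) phi i *: a`_i.

Lemma oinner_osum phi psi a :
  oinner (osum phi a) (osum psi a) =
  \sum_(i < size a) \sum_(j < size a) phi i * psi j * oinner a`_i a`_j.
Proof.
rewrite oinner_suml; apply: eq_bigr => i _; rewrite oinner_sumr.
by apply: eq_bigr => j _; rewrite oinnerZl oinnerZr mulrA.
Qed.

Lemma osum_linear phi psi (s t : R) a :
  osum (fun i => s * phi i + t * psi i) a = s *: osum phi a + t *: osum psi a.
Proof.
rewrite /osum !scaler_sumr -big_split /=; apply: eq_bigr => i _.
by rewrite scalerDl !scalerA.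
Qed.

Definition re_pow z i : R := complex.Re (z ^+ i).
Definition im_pow z i : R := complex.Im (z ^+ i).

Lemma re_powS z i :
  re_pow z i.+1 = complex.Re z * re_pow z i + - complex.Im z * im_pow z i.
Proof.
by rewrite /re_pow /im_pow exprS mulNr; case: z (z ^+ i) => [p q] [r s].
Qed.

Lemma im_powS z i :
  im_pow z i.+1 = complex.Im z * re_pow z i + complex.Re z * im_pow z i.
Proof.
rewrite /re_pow /im_pow exprS addrC.
by case: z (z ^+ i) => [p q] [r s].
Qed.

Lemma osum_re_powS z a :
  osum (fun i => re_pow z i.+1) a =
  complex.Re z *: osum (re_pow z) a + - complex.Im z *: osum (im_pow z) a.
Proof. by rewrite -osum_linear; apply: eq_bigr => i _; rewrite re_powS. Qed.

Lemma osum_im_powS z a :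
  osum (fun i => im_pow z i.+1) a =
  complex.Im z *: osum (re_pow z) a + complex.Re z *: osum (im_pow z) a.
Proof. by rewrite -osum_linear; apply: eq_bigr => i _; rewrite im_powS. Qed.

(** The span of 1 and [I] is a copy of the complex numbers. *)
Lemma opow_polar (I : octonion R) z i : imag_unit I ->
  opow (complex.Re z *: oone R + complex.Im z *: I) i =
  re_pow z i *: oone R + im_pow z i *: I.
Proof.
move=> uI; elim: i => [|i IH].
  by rewrite /re_pow /im_pow expr0 /= scale1r scale0r addr0.
rewrite /opow iterS -/(opow _ i) IH re_powS im_powS.
rewrite omulDr !omulZr omul1r omulDl !omulZl omul1l (imag_unit_sqr uI).
rewrite !scalerDr !scalerN !scalerA !scalerDl mulNr scaleNr.
rewrite [X in _ + X]addrC addrACA !(mulrC (re_pow z i)).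
by rewrite !(mulrC (im_pow z i)).
Qed.

(** Neither sum depends on [I]: on a sphere the value is affine in the imaginary unit. *)
Lemma oeval_polar (I : octonion R) z a : imag_unit I ->
  oeval a (complex.Re z *: oone R + complex.Im z *: I) =
  osum (re_pow z) a + omul I (osum (im_pow z) a).
Proof.
move=> uI; rewrite omul_sumr -big_split /=; apply: eq_bigr => i _.
by rewrite opow_polar // omulDl !omulZl omul1l omulZr.
Qed.

(* [a] evaluated at [z] in the complexified octonions is [U + i V] with
   [U = osum (re_pow z) a] and [V = osum (im_pow z) a]; its complex quadratic norm
   is [|U|^2 - |V|^2 + 2 i <U, V>]. *)
Definition onull z a : Prop :=
  oinner (osum (re_pow z) a) (osum (re_pow z) a) =
    oinner (osum (im_pow z) a) (osum (im_pow z) a) /\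
  oinner (osum (re_pow z) a) (osum (im_pow z) a) = 0.

(** Here U = - I V; left multiplication by [I] is an isometry and sends V to a vector orthogonal to
    V. *)
Lemma onull_zero (I : octonion R) z a : imag_unit I ->
  oeval a (complex.Re z *: oone R + complex.Im z *: I) = 0 -> onull z a.
Proof.
move=> uI; rewrite (oeval_polar _ _ uI) /onull.
move: (osum (re_pow z) a) (osum (im_pow z) a) => U V.
move/eqP; rewrite addr_eq0 => /eqP ->; case: uI => re0 n1; split.
  by rewrite -scaleN1r oinnerZl oinnerZr oinner_mull n1 mulrA mulrNN !mul1r.
by rewrite -scaleN1r oinnerZl oinner_mull_self re0 mul0r mulr0.
Qed.

Lemma zero_onull z a : onull z a ->
  exists2 I, imag_unit I &
    oeval a (complex.Re z *: oone R + complex.Im z *: I) = 0.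
Proof.
rewrite /onull => UV.
suff [I uI I0] : exists2 I, imag_unit I &
    osum (re_pow z) a + omul I (osum (im_pow z) a) = 0.
  by exists I => //; rewrite (oeval_polar _ _ uI).
move: (osum (re_pow z) a) (osum (im_pow z) a) UV => U V [UV UV0].
(* If V = 0 then U = 0 too, as their norms agree, and any unit works. *)
have [n0|n0] := eqVneq (oinner V V) 0.
  have [I uI] := imag_unit_exists R; exists I => //.
  by rewrite (oinner_eq0 n0) omulx0 addr0; apply: oinner_eq0; rewrite UV.
have [I IV ReI] : exists2 I, omul I V = - U & oRe I = 0.
  (* The right quotient of - U by V; its real part is a multiple of <U, V>. *)
  exists (- (oinner V V)^-1 *: omul U (oconj V)).
    by rewrite omulZl omulVK scalerA mulNr (mulVf n0) scaleN1r.
  by rewrite oReZ [oRe _]UV0 mulr0.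
exists I; last by rewrite IV subrr.
(* [I] has norm 1 because I V = - U and |U| = |V|. *)
split=> //; apply: (mulIf n0); rewrite -oinner_mull IV mul1r -UV.
by rewrite -scaleN1r oinnerZl oinnerZr mulrA mulrNN !mul1r.
Qed.

(** * Left multiplication by a linear factor *)

Lemma nth_ostar_Xsub0 al a : (ostar (oXsub al) a)`_0 = - omul al a`_0.
Proof.
by rewrite nth_mkseq // big_ord_recl big_ord0 addr0 /= omulNl.
Qed.

Lemma nth_ostar_XsubS al a k : (k < size a)%N ->
  (ostar (oXsub al) a)`_k.+1 = a`_k - omul al a`_k.+1.
Proof.
move=> ka; rewrite nth_mkseq // !big_ord_recl /= big1 => [|i _]; last first.
  by rewrite /= nth_nil -(scale0r 0) omulZl !scale0r.
by rewrite /bump /= subn0 subn1 /= omulNl omul1l addr0 addrC.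
Qed.

Lemma size_ostar_Xsub al a : size (ostar (oXsub al) a) = (size a).+1.
Proof. by rewrite size_mkseq. Qed.

Lemma osum_ostar phi al a :
  osum phi (ostar (oXsub al) a) =
  osum (fun i => phi i.+1) a - omul al (osum phi a).
Proof.
(* The added term has default coefficient 0; it matches the length of the product. *)
have -> : osum phi a = \sum_(i < (size a).+1) phi i *: a`_i.
  by rewrite big_ord_recr /= (nth_default _ (leqnn _)) scaler0 addr0.
rewrite /osum size_ostar_Xsub !big_ord_recl nth_ostar_Xsub0 omulDr.
rewrite omulZr opprD addrCA -scalerN; congr (_ + _).
rewrite omul_sumr -sumrN -big_split; apply: eq_bigr => i _.
by rewrite lift0 nth_ostar_XsubS // scalerBr omulZr.
Qed.

(* [U + i V] and its product with [ga + i q] in the complexified octonions. *)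
Lemma isotropic_mull (ga U V : octonion R) (q : R) :
  oinner U U = oinner V V -> oinner U V = 0 ->
  let U' := omul ga U - q *: V in let V' := omul ga V + q *: U in
  oinner U' U' = oinner V' V' /\ oinner U' V' = 0.
Proof.
move=> UV UV0 /=.
rewrite -scaleNr !(oinnerDl, oinnerDr, oinnerZl, oinnerZr) !oinner_mull.
have := oinner_adj ga U V; have := oinner_mull_self ga U.
have := oinner_mull_self ga V.
rewrite (oinnerC V (omul ga U)) (oinnerC V (omul ga V)).
rewrite (oinnerC U (omul ga V)) (oinnerC V U) UV UV0 mulr0 => -> ->.
(* As <U, V> = 0, [oinner_adj] makes <ga U, V> and <U, ga V> opposite. *)
by move/eqP; rewrite addr_eq0 => /eqP ->; split; ring.
Qed.

Lemma onull_ostar z al a : onull z a -> onull z (ostar (oXsub al) a).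
Proof.
(* In the complexification, z - al is ga + i Im z. *)
pose ga := complex.Re z *: oone R - al.
have UE : osum (re_pow z) (ostar (oXsub al) a) =
    omul ga (osum (re_pow z) a) - complex.Im z *: osum (im_pow z) a.
  by rewrite osum_ostar osum_re_powS omulDl omulZl omul1l omulNl scaleNr addrAC.
have VE : osum (im_pow z) (ostar (oXsub al) a) =
    omul ga (osum (im_pow z) a) + complex.Im z *: osum (re_pow z) a.
  rewrite osum_ostar osum_im_powS omulDl omulZl omul1l omulNl.
  by rewrite -addrA addrC.
by case=> UV UV0; rewrite /onull UE VE; apply: isotropic_mull.
Qed.

(** * Existence of zeros through the companion polynomial *)

Lemma complex_ReD (z w : R[i]) : complex.Re (z + w) = complex.Re z + complex.Re w.
Proof. by case: z w => [p q] [r s]. Qed.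

Lemma complex_ImD (z w : R[i]) : complex.Im (z + w) = complex.Im z + complex.Im w.
Proof. by case: z w => [p q] [r s]. Qed.

(* The companion polynomial, with value [|a(t)|^2] at real [t]. *)
Definition onorm_poly a : {poly R[i]} :=
  \sum_(i < size a) \sum_(j < size a)
    (oinner a`_i a`_j)%:C%C *: 'X^(i + j).

Lemma onorm_polyP z a : root (onorm_poly a) z -> onull z a.
Proof.
move/rootP; rewrite horner_sum.
under eq_bigr => i _ do rewrite horner_sum.
under eq_bigr => i _ do under eq_bigr => j _ do rewrite hornerZ hornerXn exprD.
move=> P0; rewrite /onull !oinner_osum; split.
  (* |U|^2 - |V|^2 is the real part of the companion polynomial at [z]. *)
  apply/eqP; rewrite -subr_eq0 -sumrB; apply/eqP.
  rewrite -[RHS]/(complex.Re (0 : R[i])) -P0 (big_morph _ complex_ReD erefl).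
  apply: eq_bigr => i _; rewrite (big_morph _ complex_ReD erefl) -sumrB.
  apply: eq_bigr => j _; rewrite /re_pow /im_pow.
  case: (z ^+ i) => p q; case: (z ^+ j) => r s /=; ring.
(* The imaginary part is 2 <U, V>: swapping the indices in one of two copies of <U, V> produces the
   imaginary part of [z ^+ (i + j)]. *)
apply: (@mulfI _ 2%:R); rewrite ?pnatr_eq0 // mulr0.
rewrite -[RHS]/(complex.Im (0 : R[i])) -P0 (big_morph _ complex_ImD erefl).
under [RHS]eq_bigr => i _ do rewrite (big_morph _ complex_ImD erefl).
rewrite mulr_natl mulr2n {2}exchange_big /= -big_split /=.
apply: eq_bigr => i _; rewrite -big_split /=; apply: eq_bigr => j _.
rewrite (oinnerC a`_j) /re_pow /im_pow.
case: (z ^+ i) => p q; case: (z ^+ j) => r s /=; ring.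
Qed.

(** The coefficient of degree 2m is the squared norm of the leading coefficient of [f], hence
    nonzero. *)
Lemma size_onorm_poly f : (1 < size f)%N -> (1 < size (onorm_poly f))%N.
Proof.
case: f => a a0 /=; case sa : (size a) => [//|m] m0; rewrite ltnS in m0.
suff cm : (onorm_poly a)`_(m + m) != 0.
  rewrite ltnNge; apply: contra cm => h.
  by rewrite nth_default // (leq_trans h) // addn_gt0 m0.
rewrite /onorm_poly sa coef_sum big_ord_recr /= big1 => [|i _]; last first.
  rewrite coef_sum big1 // => j _; rewrite coefZ coefXn.
  by rewrite gtn_eqF ?mulr0 // -addSn leq_add //= -ltnS.
rewrite add0r coef_sum big_ord_recr /= big1 => [|i _]; last first.
  by rewrite coefZ coefXn gtn_eqF ?mulr0 //= ltn_add2l.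
rewrite add0r coefZ coefXn eqxx mulr1 eq_complex /= eqxx andbT.
apply: contra a0 => /eqP /oinner_eq0.
by rewrite -nth_last sa /= => ->.
Qed.

Lemma ozeros_exists f : (1 < size f)%N -> exists w, ozeros f w.
Proof.
move/size_onorm_poly => s1.
have /closed_rootP [z /onorm_polyP /zero_onull [I _ fI]] :
  size (onorm_poly f) != 1%N by rewrite gtn_eqF.
by exists (complex.Re z *: oone R + complex.Im z *: I).
Qed.

(** * Horner division and iterated factorization *)

Definition ohorner al a : octonion R := foldr (fun c r => c + omul al r) 0 a.

Lemma oeval_horner al a : oeval a al = ohorner al a.
Proof.
elim: a => [|c a IH]; first by rewrite /oeval big_ord0.
rewrite /oeval big_ord_recl /= omul1l -IH; congr (_ + _).
by rewrite omul_sumr; apply: eq_bigr => i _; rewrite omul_powS.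
Qed.

(** The coefficients of the quotient are the Horner values at [al] of the proper tails of [f]; the
    remainder is the value of [f] at [al]. *)
Lemma factor_zero f al : (1 < size f)%N -> ozeros f al ->
  exists g : regpoly R,
    ocoefs f = ostar (oXsub al) g /\ size f = (size g).+1.
Proof.
case: f => a a0 /= a1; rewrite /ozeros /= oeval_horner => h0.
have hornerS i : (i < size a)%N ->
    ohorner al (drop i a) = a`_i + omul al (ohorner al (drop i.+1 a)).
  by move=> ia; rewrite (drop_nth 0 ia).
have [b sb bE] : exists2 b : seq (octonion R), size a = (size b).+1 &
    forall i, b`_i = ohorner al (drop i.+1 a).
  have pa : (size a).-1.+1 = size a by rewrite prednK // ltnW.
  exists (mkseq (fun i => ohorner al (drop i.+1 a)) (size a).-1) => [|i].
    by rewrite size_mkseq pa.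
  have [ib|bi] := ltnP i (size a).-1; first by rewrite nth_mkseq.
  by rewrite nth_default ?size_mkseq // drop_oversize // -pa ltnS.
(* The quotient keeps the leading coefficient of [f]. *)
have b0 : last 0 b != 0.
  rewrite -nth_last bE; case sb' : (size b) => [|k].
    by rewrite sb sb' in a1.
  rewrite /= -sb' (drop_nth 0) ?sb // drop_oversize ?sb //= omulx0 addr0.
  by move: a0; rewrite -nth_last sb.
exists (RegPoly b0); split=> //=.
apply: (@eq_from_nth _ 0) => [|i ia]; first by rewrite size_ostar_Xsub.
case: i ia => [|i] ia.
  rewrite nth_ostar_Xsub0 bE; apply/eqP; rewrite -addr_eq0 -hornerS //.
  by rewrite drop0 h0.
by rewrite nth_ostar_XsubS -?sb -1?ltnS -?sb // !bE (hornerS _ ia) addrK.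
Qed.

(** [onull] sees only the sphere, encoded by [z]; the zero of [b] lies on the same sphere with
    possibly another unit [J]. *)
Lemma zero_conjugate w a b :
  oeval a w = 0 -> (forall z, onull z a -> onull z b) ->
  exists2 w', oeval b w' = 0 & oconjugate w w'.
Proof.
move=> aw ab; have [I uI wE] := oct_polar w.
pose z := (oRe w +i* onorm (oIm w))%C.
have /ab /zero_onull [J uJ bJ] : onull z a.
  by apply: (onull_zero uI); rewrite /= -oreal_scale -wE.
exists (oRe w *: oone R + onorm (oIm w) *: J) => //.
by exists J; [exact: imag_unit_sqr | rewrite oreal_scale].
Qed.

(** Indices start at 0, and the final constant is kept as the polynomial [F m.+1], so that all steps
    have one form. *)
Lemma linear_factorization m f al :
  size f = m.+2 -> ozeros f al ->
  exists (alpha : nat -> octonion R) (c : octonion R) (F : nat -> regpoly R),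
    [/\ alpha 0%N = al, F 0%N = f, ocoefs (F m.+1) = oconst c &
      forall k, (k <= m)%N ->
        ocoefs (F k) = ostar (oXsub (alpha k)) (F k.+1) /\
        ozeros (F k) (alpha k)].
Proof.
elim: m f al => [|m IH] f al sf fal.
  have [|g [fg]] := factor_zero _ fal; first by rewrite sf.
  rewrite sf => -[] sg.
  exists (fun=> al), g`_0, (fun k => if k is 0%N then f else g); split=> //.
    by case: (ocoefs g) sg => [//|c []].
  by case.
have [|g [fg]] := factor_zero _ fal; first by rewrite sf.
rewrite sf => -[] sg; have [|be gbe] := @ozeros_exists g; first by rewrite -sg.
have [alpha [c [F [a0 F0 Fc FE]]]] := IH g be (esym sg) gbe.
exists (fun k => if k is k'.+1 then alpha k' else al), c.
exists (fun k => if k is k'.+1 then F k' else f); split=> // -[_|k km].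
  by rewrite F0.
exact: FE.
Qed.

End OctonionPolynomials.

Theorem corollary12 (R : realType) (n : nat) (f : regpoly R)
    (alpha1 : octonion R) :
  (0 < n)%N -> odegree f = n -> ozeros f alpha1 ->
  exists (alpha : nat -> octonion R) (c : octonion R) (F : nat -> regpoly R),
    [/\ alpha 1%N = alpha1,
        c != 0,
        F 0%N = f,
        (forall k : nat, (k < n.-1)%N ->
           ocoefs (F k) = ostar (oXsub (alpha k.+1)) (F k.+1))
          /\ ocoefs (F n.-1) = ostar (oXsub (alpha n)) (oconst c)
      & forall k : nat, (1 <= k <= n.-1)%N ->
          ozeros (F k) (alpha k.+1) /\
          exists2 alpha' : octonion R,
            ozeros f alpha' & oconjugate (alpha k.+1) alpha'].
Proof.
case: n => [//|m] _ fm fz.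
have sf : size f = m.+2.
  by move: fm; rewrite /odegree; case: (size f) => [|k] //= ->.
have [alpha [c [F [a0 F0 Fc FE]]]] := linear_factorization sf fz.
exists (fun k => alpha k.-1), c, F; split=> //.
(* [c] is the leading coefficient of the regular polynomial [F m.+1]. *)
- by case: (F m.+1) Fc => a a0' /= ac; move: a0'; rewrite ac.
- split=> [k km|]; first by case: (FE k (ltnW km)).
  by rewrite -Fc; case: (FE m (leqnn m)).
move=> k /andP [_ km]; have [_ Fk0] := FE k km; split=> //.
apply: (zero_conjugate Fk0) => z; rewrite -F0.
(* Nullity at [z] passes from [F k] back to [F 0], one linear factor at a time. *)
elim: k km {Fk0} => [_|k IH km Fk]; [exact | apply: IH; first exact: ltnW].
by case: (FE k (ltnW km)) => -> _; apply: onull_ostar.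
Qed.
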